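(* Let $\mathcal{Q}=(Q,\&)$ be a dually meet continuous quantale. Then for every $\mathcal{Q}$-ordered set $A$, every forward Cauchy ideal of $A$ is an irreducible ideal of $A$.
   Context: A quantale $\mathcal{Q}=(Q,\&)$ is always assumed integral and commutative: $Q$ is a complete lattice (bottom $0$, top $1$) and $\&$ is a commutative associative operation on $Q$ with unit $1$ that distributes over arbitrary joins. Its implication $\to$ is defined by $p\&q\le r\iff q\le p\to r$. A complete lattice $L$ is meet continuous if $a\wedge\bigvee D=\bigvee_{d\in D}(a\wedge d)$ for all $a\in L$ and all directed $D\subseteq L$; it is dually meet continuous if its opposite is meet continuous. $\mathcal{Q}$ is dually meet continuous if the lattice $Q$ is. A $\mathcal{Q}$-ordered set is a set $A$ with a map $A(-,-):A\times A\to Q$ such that $A(x,x)=1$ and $A(y,z)\&A(x,y)\le A(x,z)$ for all $x,y,z\in A$. A fuzzy lower set of $A$ is a map $\phi:A\to Q$ with $\phi(y)\&A(x,y)\le\phi(x)$ for all $x,y$. Joins of maps $A\to Q$ are pointwise. For fuzzy lower sets, $\mathrm{sub}_A(\phi_1,\phi_2)=\bigwedge_{x\in A}(\phi_1(x)\to\phi_2(x))$. A map $\lambda:A\to Q$ is inhabited if $\bigvee_{a\in A}\lambda(a)=1$. A net $\{x_i\}$ in $A$ is forward Cauchy if $\bigvee_i\bigwedge_{i\le j\le k}A(x_j,x_k)=1$. A fuzzy lower set $\phi$ of $A$ is a forward Cauchy ideal if $\phi=\bigvee_i\bigwedge_{j\ge i}A(-,x_j)$ for some forward Cauchy net $\{x_i\}$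 in $A$. A fuzzy lower set $\phi$ is an irreducible ideal if it is inhabited and $\mathrm{sub}_A(\phi,\phi_1\vee\phi_2)=\mathrm{sub}_A(\phi,\phi_1)\vee\mathrm{sub}_A(\phi,\phi_2)$ for all fuzzy lower sets $\phi_1,\phi_2$ of $A$. *)

(* Defs.v *)
From HB Require Import structures.
From mathcomp Require Import all_boot all_order.
From mathcomp Require Import boolp classical_sets.

Set Implicit Arguments.
Unset Strict Implicit.
Unset Printing Implicit Defensive.

Import Order.TTheory.

Local Open Scope classical_set_scope.
Local Open Scope order_scope.

HB.mixin Record isCompleteLattice (d : Order.disp_t) L of Order.TBLattice d L := {
  bigjoin : set L -> L;
  bigmeet : set L -> L;
  bigjoin_supremum : forall S : set L, supremums S (bigjoin S);
  bigmeet_infimum : forall S : set L, infimums S (bigmeet S)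
}.

#[short(type="completeLatticeType")]
HB.structure Definition CompleteLattice (d : Order.disp_t) :=
  { L of isCompleteLattice d L & Order.TBLattice d L }.

HB.instance Definition _ (d : Order.disp_t) (L : completeLatticeType d) :=
  isCompleteLattice.Build (Order.dual_display d) (L^d)%type
    (@bigmeet_infimum d L) (@bigjoin_supremum d L).

Definition directed (d : Order.disp_t) (T : preorderType d) (D : set T) : Prop :=
  D !=set0 /\
  forall x y, D x -> D y -> exists z, [/\ D z, x <= z & y <= z].

Definition meet_continuous (d : Order.disp_t) (L : completeLatticeType d) : Prop :=
  forall (a : L) (D : set L), directed D ->
    a `&` bigjoin D = bigjoin [set a `&` x | x in D].

Definition dually_meet_continuous (d : Order.disp_t) (L : completeLatticeType d)
  : Prop := meet_continuous (L^d)%type.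

HB.mixin Record isQuantale (d : Order.disp_t) Q of CompleteLattice d Q := {
  tensor : Q -> Q -> Q;
  tensorA : associative tensor;
  tensorC : commutative tensor;
  tensor1q : left_id (\top : Q) tensor;
  tensor_bigjoinr : forall (p : Q) (S : set Q),
    tensor p (bigjoin S) = bigjoin [set tensor p q | q in S]
}.

(* Integral commutative quantales only. *)
#[short(type="quantaleType")]
HB.structure Definition Quantale (d : Order.disp_t) :=
  { Q of isQuantale d Q & CompleteLattice d Q }.

Definition implication (d : Order.disp_t) (Q : quantaleType d) (p r : Q) : Q :=
  bigjoin [set q | tensor p q <= r].

Lemma implicationP (d : Order.disp_t) (Q : quantaleType d) (p q r : Q) :
  (tensor p q <= r) <-> (q <= implication p r).
Proof.
split=> [pqr|qpr].
  by case: (bigjoin_supremum [set q | tensor p q <= r]) => + _; apply.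
have mono (x y : Q) : x <= y -> tensor p x <= tensor p y.
  move=> xy; have -> : y = bigjoin [set x; y].
    apply: le_anti; apply/andP; split.
      by case: (bigjoin_supremum [set x; y]) => + _; apply; right.
    by case: (bigjoin_supremum [set x; y]) => _; apply=> z [->|->].
  rewrite tensor_bigjoinr.
  case: (bigjoin_supremum [set tensor p z | z in [set x; y]]) => + _.
  by apply; exists x => //; left.
apply: le_trans (mono _ _ qpr) _; rewrite /implication tensor_bigjoinr.
by case: (bigjoin_supremum [set tensor p z | z in [set z | tensor p z <= r]])
  => _; apply=> z [w pwr <-].
Qed.

Record qOrderedSet (d : Order.disp_t) (Q : quantaleType d) := QOrderedSet {
  qcarrier :> Type;
  hom : qcarrier -> qcarrier -> Q;
  hom_refl : forall x, hom x x = \top;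
  hom_trans : forall x y z, tensor (hom y z) (hom x y) <= hom x z
}.

Section Ideals.
Variables (d : Order.disp_t) (Q : quantaleType d) (A : qOrderedSet Q).
Implicit Types phi : A -> Q.

Definition fuzzy_lower_set phi : Prop :=
  forall x y : A, tensor (phi y) (hom x y) <= phi x.

Definition fuzzy_join phi1 phi2 : A -> Q := fun x => phi1 x `|` phi2 x.

Definition fuzzy_sub phi1 phi2 : Q :=
  bigmeet [set implication (phi1 x) (phi2 x) | x in [set: A]].

Definition fuzzy_inhabited phi : Prop :=
  bigjoin [set phi a | a in [set: A]] = \top.

Definition forward_cauchy dI (I : preorderType dI) (u : I -> A) : Prop :=
  bigjoin [set bigmeet [set hom (u p.1) (u p.2)
                       | p in [set p : I * I | i <= p.1 <= p.2]]
          | i in [set: I]] = \top.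

Definition net_lower_limit dI (I : preorderType dI) (u : I -> A) : A -> Q :=
  fun x => bigjoin [set bigmeet [set hom x (u j) | j in [set j : I | i <= j]]
                   | i in [set: I]].

Definition forward_cauchy_ideal phi : Prop :=
  fuzzy_lower_set phi /\
  exists (dI : Order.disp_t) (I : preorderType dI) (u : I -> A),
    [/\ directed [set: I], forward_cauchy u & phi = net_lower_limit u].

Definition irreducible_ideal phi : Prop :=
  [/\ fuzzy_lower_set phi,
      fuzzy_inhabited phi &
      forall phi1 phi2, fuzzy_lower_set phi1 -> fuzzy_lower_set phi2 ->
        fuzzy_sub phi (fuzzy_join phi1 phi2) =
        fuzzy_sub phi phi1 `|` fuzzy_sub phi phi2].

End Ideals.

(* Main.v *)
Require Import Defs.
From HB Require Import structures.
From mathcomp Require Import all_boot all_order.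
From mathcomp Require Import boolp classical_sets.

(** Let [u] be a forward Cauchy net in [A] and [phi] its forward Cauchy ideal.
    The proof turns the fuzzy inclusion order below [phi] into an order limit
    along the net: for every fuzzy lower set [psi],

      [sub_A(phi, psi) = liminf_j psi (u j)]      ([fuzzy_sub_liminf]).

    Irreducibility thus says that this limit inferior commutes with binary
    joins.  A limit inferior does not do so in general, but

      [liminf (f \/ g) <= limsup f \/ limsup g]   ([liminf_join_le])

    holds as soon as binary joins distribute over filtered meets, because
    a limit superior is a filtered meet; this is where dual meet continuity
    enters.  It remains to see that [limsup psi (u j) <= liminf psi (u j)]
    ([limsup_le_liminf]): a fuzzy lower set is decreasing along the net up to the
    factor [cauchy_modulus u i], and these factors have join [\top], so that
    an inequality may be checked after multiplying by each of them
    ([le_cauchy_modulus]). *)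

Set Implicit Arguments.
Unset Strict Implicit.
Unset Printing Implicit Defensive.

Import Order.TTheory.

Local Open Scope classical_set_scope.
Local Open Scope order_scope.

Section CompleteLatticeTheory.
Context {d : Order.disp_t} {L : completeLatticeType d}.
Implicit Types (S : set L) (x : L).

Lemma le_bigjoin S x : S x -> x <= bigjoin S.
Proof. by case: (bigjoin_supremum S) => + _; apply. Qed.

Lemma bigjoin_le S x : (forall y, S y -> y <= x) -> bigjoin S <= x.
Proof. by case: (bigjoin_supremum S) => _ + Sx; apply=> y /Sx. Qed.

Lemma bigmeet_le S x : S x -> bigmeet S <= x.
Proof. by case: (bigmeet_infimum S) => + _; apply. Qed.

Lemma le_bigmeet S x : (forall y, S y -> x <= y) -> x <= bigmeet S.
Proof. by case: (bigmeet_infimum S) => _ + Sx; apply=> y /Sx. Qed.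

(** This is meet continuity of [L^d], up to conversion: the dual instance swaps
    [bigjoin] with [bigmeet], and directed sets of [L^d] are filtered in [L]. *)
Lemma join_bigmeet (a : L) S : dually_meet_continuous L -> S !=set0 ->
  (forall x y, S x -> S y -> exists z, [/\ S z, z <= x & z <= y]) ->
  a `|` bigmeet S = bigmeet [set a `|` x | x in S].
Proof. by move=> hL S0 Sfilt; apply: (hL a S); split. Qed.

End CompleteLatticeTheory.

Section OrderLimits.
Context {d dI : Order.disp_t} {L : completeLatticeType d} {I : preorderType dI}.
Hypothesis dirI : directed [set: I].
Implicit Types f g : I -> L.

Definition tail_meet f i := bigmeet [set f j | j in [set j | i <= j]].
Definition tail_join f i := bigjoin [set f j | j in [set j | i <= j]].
Definition liminf f := bigjoin [set tail_meet f i | i in [set: I]].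
Definition limsup f := bigmeet [set tail_join f i | i in [set: I]].

Lemma tail_meet_le f i j : i <= j -> tail_meet f i <= f j.
Proof. by move=> ij; apply: bigmeet_le; exists j. Qed.

Lemma le_tail_join f i j : i <= j -> f j <= tail_join f i.
Proof. by move=> ij; apply: le_bigjoin; exists j. Qed.

Lemma tail_join_anti f i j : i <= j -> tail_join f j <= tail_join f i.
Proof.
by move=> ij; apply: bigjoin_le => _ [k jk <-]; apply/le_tail_join/(le_trans ij).
Qed.

Lemma tail_meet_le_liminf f i : tail_meet f i <= liminf f.
Proof. by apply: le_bigjoin; exists i. Qed.

Lemma limsup_le_tail_join f i : limsup f <= tail_join f i.
Proof. by apply: bigmeet_le; exists i. Qed.

Lemma directed_ub i j : exists k : I, i <= k /\ j <= k.
Proof. by case: dirI => _ /(_ i j Logic.I Logic.I) [k [_ ? ?]]; exists k. Qed.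

Lemma join_limsup (a : L) f : dually_meet_continuous L ->
  a `|` limsup f = bigmeet [set a `|` tail_join f i | i in [set: I]].
Proof.
move=> hL; rewrite /limsup join_bigmeet ?image_comp //.
- by case: dirI => [[i _] _]; exists (tail_join f i), i.
- move=> _ _ [i _ <-] [j _ <-]; have [k [ik jk]] := directed_ub i j.
  by exists (tail_join f k); split; [exists k|apply: tail_join_anti..].
Qed.

(** Distributing the join over both limits superior leaves one inequality for
    each pair of indices [i], [j]; the two tails and the tail of the limit
    inferior are then compared at a common later index. *)
Lemma liminf_join_le f g : dually_meet_continuous L ->
  liminf (fun i => f i `|` g i) <= limsup f `|` limsup g.
Proof.
move=> hL; rewrite join_limsup //; apply: le_bigmeet => _ [j _ <-].
rewrite joinC join_limsup //; apply: le_bigmeet => _ [i _ <-].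
apply: bigjoin_le => _ [k _ <-].
have [m [im jm]] := directed_ub i j; have [n [mn kn]] := directed_ub m k.
apply: le_trans (tail_meet_le _ kn) _; rewrite joinC.
by apply: leU2; apply/le_tail_join/(le_trans _ mn).
Qed.

End OrderLimits.

Section QuantaleTheory.
Context {d : Order.disp_t} {Q : quantaleType d}.
Implicit Types p q r : Q.

Lemma tensorSr p q r : q <= r -> tensor p q <= tensor p r.
Proof. by move=> qr; apply/implicationP/(le_trans qr)/implicationP. Qed.

Lemma tensorSl p q r : p <= q -> tensor p r <= tensor q r.
Proof. by rewrite ![tensor _ r]tensorC; apply: tensorSr. Qed.

Lemma tensorS p p' q q' : p <= p' -> q <= q' -> tensor p q <= tensor p' q'.
Proof. by move=> pp' qq'; apply: le_trans (tensorSl _ pp') (tensorSr _ qq'). Qed.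

Lemma tensor_bigjoin_le p (S : set Q) r :
  (forall q, S q -> tensor p q <= r) -> tensor p (bigjoin S) <= r.
Proof. by move=> Sr; apply/implicationP/bigjoin_le => q /Sr/implicationP. Qed.

End QuantaleTheory.

Section FuzzySub.
Context {d : Order.disp_t} {Q : quantaleType d} {A : qOrderedSet Q}.
Implicit Types phi psi : A -> Q.

Lemma le_fuzzy_sub phi psi r :
  (forall x, tensor (phi x) r <= psi x) -> r <= fuzzy_sub phi psi.
Proof. by move=> le_r; apply: le_bigmeet => _ [x _ <-]; apply/implicationP. Qed.

Lemma tensor_fuzzy_sub phi psi x : tensor (phi x) (fuzzy_sub phi psi) <= psi x.
Proof. by apply/implicationP/bigmeet_le; exists x. Qed.

Lemma fuzzy_sub_mono phi psi psi' : (forall x, psi x <= psi' x) ->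
  fuzzy_sub phi psi <= fuzzy_sub phi psi'.
Proof.
by move=> le_psi; apply: le_fuzzy_sub => x; apply: le_trans (le_psi x);
  apply: tensor_fuzzy_sub.
Qed.

Lemma fuzzy_lower_set_join phi psi : fuzzy_lower_set phi ->
  fuzzy_lower_set psi -> fuzzy_lower_set (fuzzy_join phi psi).
Proof.
move=> low_phi low_psi x y; rewrite tensorC; apply/implicationP.
rewrite leUx; apply/andP; split; apply/implicationP; rewrite tensorC.
- exact: le_trans (low_phi x y) (leUl _ _).
- exact: le_trans (low_psi x y) (leUr _ _).
Qed.

End FuzzySub.

Section ForwardCauchyNet.
Context {d dI : Order.disp_t} {Q : quantaleType d} {A : qOrderedSet Q}.
Context {I : preorderType dI}.
Variable u : I -> A.
Hypotheses (dirI : directed [set: I]) (cauchy_u : forward_cauchy u).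
Implicit Types psi : A -> Q.

Definition cauchy_modulus (i : I) : Q :=
  bigmeet [set hom (u p.1) (u p.2) | p in [set p : I * I | i <= p.1 <= p.2]].

Lemma cauchy_modulus_le i j k : i <= j -> j <= k ->
  cauchy_modulus i <= hom (u j) (u k).
Proof. by move=> ij jk; apply: bigmeet_le; exists (j, k) => //=; apply/andP. Qed.

Lemma le_cauchy_modulus p q :
  (forall i, tensor (cauchy_modulus i) p <= q) -> p <= q.
Proof.
move=> le_q; rewrite -[p]tensor1q -cauchy_u tensorC.
by apply: tensor_bigjoin_le => _ [i _ <-]; rewrite tensorC; apply: le_q.
Qed.

Lemma cauchy_modulus_le_limit i j : i <= j ->
  cauchy_modulus i <= net_lower_limit u (u j).
Proof.
move=> ij; apply: le_trans (tail_meet_le_liminf (fun k => hom (u j) (u k)) j).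
by apply: le_bigmeet => _ [k jk <-]; apply: cauchy_modulus_le.
Qed.

Lemma net_lower_limit_inhabited : fuzzy_inhabited (net_lower_limit u).
Proof.
apply/le_anti; rewrite lex1 -cauchy_u /=; apply: bigjoin_le => _ [i _ <-].
apply: le_trans (cauchy_modulus_le_limit (lexx i)) _.
by apply: le_bigjoin; exists (u i).
Qed.

(** For [<=], the value of [net_lower_limit u] at a late [u j] is at least the
    Cauchy modulus, so the degree of inclusion is nearly a lower bound of
    [psi (u j)].  For [>=], a lower bound of the tail of [psi \o u] and one of
    the tail of [hom x \o u] are multiplied at a common index. *)
Lemma fuzzy_sub_liminf psi : fuzzy_lower_set psi ->
  fuzzy_sub (net_lower_limit u) psi = liminf (psi \o u).
Proof.
move=> low_psi; apply/le_anti/andP; split.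
- apply: le_cauchy_modulus => i.
  apply: le_trans (tail_meet_le_liminf _ i).
  apply: le_bigmeet => _ [j ij <-]; apply: le_trans (tensor_fuzzy_sub _ _ _).
  exact/tensorSl/cauchy_modulus_le_limit.
- apply: le_fuzzy_sub => x; apply: tensor_bigjoin_le => _ [i _ <-].
  rewrite tensorC; apply: tensor_bigjoin_le => _ [k _ <-].
  have [m [im km]] := directed_ub dirI i k.
  apply: le_trans (low_psi x (u m)); apply: tensorS.
  + exact: (tail_meet_le (psi \o u) im).
  + exact: (tail_meet_le (fun j => hom x (u j)) km).
Qed.

(** For [i <= j <= k], [psi (u k)] multiplied by the modulus at [i] is below
    [psi (u j)], and [tensor] distributes over the join of the [psi (u k)]. *)
Lemma limsup_le_liminf psi : fuzzy_lower_set psi ->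
  limsup (psi \o u) <= liminf (psi \o u).
Proof.
move=> low_psi; apply: le_cauchy_modulus => i.
apply: le_trans (tail_meet_le_liminf _ i).
apply: le_bigmeet => _ [j ij <-].
apply: le_trans (tensorSr _ (limsup_le_tail_join _ j)) _.
apply: tensor_bigjoin_le => _ [k jk <-]; apply: le_trans (low_psi _ (u k)).
by rewrite tensorC; apply/tensorSr/cauchy_modulus_le.
Qed.

End ForwardCauchyNet.

Theorem theorem3p10 (d : Order.disp_t) (Q : quantaleType d)
  (hQ : dually_meet_continuous Q) (A : qOrderedSet Q) (phi : A -> Q) :
  forward_cauchy_ideal phi -> irreducible_ideal phi.
Proof.
case=> low_phi [dI [I [u [dirI cauchy_u def_phi]]]].
split=> //; first by rewrite def_phi; apply: net_lower_limit_inhabited.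
move=> psi1 psi2 low1 low2; apply/le_anti/andP; split.
- have low12 := fuzzy_lower_set_join low1 low2.
  rewrite def_phi !fuzzy_sub_liminf //.
  apply: le_trans (liminf_join_le dirI (psi1 \o u) (psi2 \o u) hQ) _.
  by apply: leU2; apply: limsup_le_liminf.
- rewrite leUx; apply/andP; split; apply: fuzzy_sub_mono => x.
  + exact: leUl.
  + exact: leUr.
Qed.
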